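(* There exist a mean-payoff game $\mathcal{G}$, a vertex $v$ of $\mathcal{G}$, and $\epsilon>0$ such that a finite memory strategy $\sigma_0$ of Player 0 that cannot be represented by any memoryless strategy suffices to achieve $\mathsf{ASV}^{\epsilon}(v)$, i.e. $\mathsf{ASV}^{\epsilon}(\sigma_0)(v)=\mathsf{ASV}^{\epsilon}(v)$.
   Context: An arena $(V,E,\langle V_0,V_1\rangle,w_0,w_1)$ consists of a finite set $V$ of vertices, a set $E\subseteq V\times V$ of edges such that every vertex has at least one successor, a partition of $V$ into $V_0$ (Player 0) and $V_1$ (Player 1), and weight functions $w_0,w_1:E\to\mathbb{Z}$. A mean-payoff game $\mathcal{G}$ is played on such an arena. A play is an infinite path $\pi=\pi_0\pi_1\dots$; a history is a nonempty finite prefix of a play. The payoff of Player $i\in\{0,1\}$ is $\underline{\mathsf{MP}}_i(\pi)=\liminf_{k\to\infty}\frac1k w_i(\pi_0\dots\pi_k)$, where $w_i$ of a history is the sum of the $w_i$-weights of its edges. A strategy of Player $i$ maps each history ending in a vertex of $V_i$ to a successor of that last vertex; $\Sigma_i$ is the set of strategies of Player $i$. $\mathsf{Out}_v(\sigma_0,\sigma_1)$ is the unique play from $v$ consistent with $\sigma_0$ and $\sigma_1$. A strategy is finite memory if it can be realized as the output of a state machine with finitely many states; it is memoryless if it depends only on the last vertex of the history. For $\epsilon>0$, $\mathsf{BR}^{\epsilon}_{1}(\sigma_0)$ is the set of $\sigma_1\in\Sigma_1$ such that for all $v\in V$ and all $\sigma_1'\in\Sigma_1$: $\underline{\mathsf{MP}}_1(\mathsf{Out}_v(\sigma_0,\sigma_1))>\underline{\mathsf{MP}}_1(\mathsf{Out}_v(\sigma_0,\sigma_1'))-\epsilon$.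 Then $\mathsf{ASV}^{\epsilon}(\sigma_0)(v)=\inf_{\sigma_1\in\mathsf{BR}^{\epsilon}_1(\sigma_0)}\underline{\mathsf{MP}}_0(\mathsf{Out}_v(\sigma_0,\sigma_1))$ and $\mathsf{ASV}^{\epsilon}(v)=\sup_{\sigma_0\in\Sigma_0}\mathsf{ASV}^{\epsilon}(\sigma_0)(v)$. *)

(* Defs.v *)
From HB Require Import structures.
From mathcomp Require Import all_boot all_order all_algebra.
From mathcomp Require Import boolp classical_sets reals ereal topology normedtype sequences.

Set Implicit Arguments.
Unset Strict Implicit.
Unset Printing Implicit Defensive.

Import Order.TTheory GRing.Theory Num.Theory.

Local Open Scope classical_set_scope.
Local Open Scope ring_scope.

Inductive player := P0 | P1.

(* [owner] encodes the partition of the vertices into V_0 and V_1.  Weights are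
   total on pairs of vertices, but only their values on edges are ever used. *)
Record arena := Arena {
  vertex :> finType;
  edge : rel vertex;
  edge_total : forall u : vertex, exists u' : vertex, edge u u';
  owner : vertex -> player;
  weight : player -> vertex -> vertex -> int
}.

(* A history is a nonempty finite path, given by its first vertex [v] and the
   sequence [p] of the following ones; it ends in [last v p].  As every vertex
   has a successor, these are exactly the nonempty finite prefixes of plays. *)
Definition history (G : arena) (v : G) (p : seq G) : Prop := path (@edge G) v p.

(* Only the values on histories ending in a vertex of the player matter. *)
Record strategy (G : arena) (i : player) := Strategy {
  move_of :> G -> seq G -> G;
  move_ofP : forall (v : G) (p : seq G),
    history v p -> owner (last v p) = i -> edge (last v p) (move_of v p)
}.

Definition memoryless (G : arena) (i : player) (s : strategy G i) : Prop :=
  exists f : G -> G, forall (v : G) (p : seq G),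
    history v p -> owner (last v p) = i -> s v p = f (last v p).

(* The machine [(M, m0, upd, out)] reads all the vertices of the history but
   the last one; its output depends on the state reached and the last vertex. *)
Definition finite_memory (G : arena) (i : player) (s : strategy G i) : Prop :=
  exists (M : finType) (m0 : M) (upd : M -> G -> M) (out : M -> G -> G),
    forall (v : G) (p : seq G), history v p -> owner (last v p) = i ->
      s v p = out (foldl upd m0 (belast v p)) (last v p).

Section Outcome.
Variables (G : arena) (s0 : strategy G P0) (s1 : strategy G P1) (v : G).

Definition next_move (p : seq G) : G :=
  match owner (last v p) with P0 => s0 v p | P1 => s1 v p end.

Fixpoint outcome_prefix (n : nat) : seq G :=
  if n is m.+1 then
    let p := outcome_prefix m in rcons p (next_move p)
  else [::].

Definition outcome (n : nat) : G := last v (outcome_prefix n).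

End Outcome.

Section Values.
Variables (R : realType) (G : arena).

(* Payoffs are bounded by the largest absolute value of a weight; extended
   reals only serve to have total lower limits, infima and suprema. *)
Definition mean_payoff (i : player) (pi : nat -> G) : \bar R :=
  limn_einf (fun k : nat =>
    (k%:R^-1 * (\sum_(j < k) weight i (pi j) (pi j.+1))%:~R)%:E).

Definition best_response (eps : R) (s0 : strategy G P0) : set (strategy G P1) :=
  [set s1 | forall (v : G) (s1' : strategy G P1),
     (mean_payoff P1 (outcome s0 s1' v) - eps%:E
        < mean_payoff P1 (outcome s0 s1 v))%E].

(* The set of responses is nonempty whenever [0 < eps]. *)
Definition ASV_of (eps : R) (s0 : strategy G P0) (v : G) : \bar R :=
  ereal_inf [set mean_payoff P0 (outcome s0 s1 v)
            | s1 in best_response eps s0].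

Definition ASV (eps : R) (v : G) : \bar R :=
  ereal_sup [set ASV_of eps s0 v | s0 in [set: strategy G P0]].

End Values.

(* Main.v *)
(** Player 0 owns [Hub] and Player 1 owns [Fork]; the edges are
    [Hub -> Fork | Lose], [Fork -> Hub | Win] and the loops on [Win], [Lose].
    The payoffs (for Players 0 and 1) are (1, 0) in [Win], (0, -1) in [Lose] and
    (0, 1) on the cycle between [Hub] and [Fork].  To obtain 1, Player 0 must
    visit [Fork], so as to make [Win] available, but must not let Player 1 cycle:
    she moves to [Fork] once and to [Lose] if Player 1 comes back, and then,
    with epsilon = 1, all the responses of Player 1 that end in [Lose] are
    excluded.  A memoryless strategy gives either the cycle or [Lose] from [Hub],
    hence 0. *)
Require Import Defs.
From HB Require Import structures.
From mathcomp Require Import all_boot all_order all_algebra.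
From mathcomp Require Import boolp classical_sets reals ereal topology normedtype sequences.

Set Implicit Arguments.
Unset Strict Implicit.
Unset Printing Implicit Defensive.

Import Order.TTheory GRing.Theory Num.Theory.

Import numFieldNormedType.Exports.

Local Open Scope ring_scope.

(** * Plays, eventually constant weights and best responses in any arena *)

Section Outcomes.
Variables (G : arena) (s0 : strategy G P0) (s1 : strategy G P1) (v : G).

Lemma outcomeS n :
  outcome s0 s1 v n.+1 = next_move s0 s1 v (outcome_prefix s0 s1 v n).
Proof. by rewrite /outcome /= last_rcons. Qed.

Lemma next_move_edge p :
  history v p -> edge (last v p) (next_move s0 s1 v p).
Proof.
move=> vp; rewrite /next_move.
by case own: (owner (last v p)); exact: move_ofP.
Qed.

Lemma outcome_prefix_history n : history v (outcome_prefix s0 s1 v n).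
Proof.
elim: n => [//|n IHn] /=.
by rewrite /history rcons_path next_move_edge // andbT.
Qed.

Lemma outcome_edge n :
  edge (outcome s0 s1 v n) (outcome s0 s1 v n.+1).
Proof.
by rewrite outcomeS; apply: next_move_edge; exact: outcome_prefix_history.
Qed.

Lemma outcomeS_P0 n : owner (outcome s0 s1 v n) = P0 ->
  outcome s0 s1 v n.+1 = s0 v (outcome_prefix s0 s1 v n).
Proof. by rewrite outcomeS /next_move -/(outcome s0 s1 v n) => ->. Qed.

Lemma outcomeS_P1 n : owner (outcome s0 s1 v n) = P1 ->
  outcome s0 s1 v n.+1 = s1 v (outcome_prefix s0 s1 v n).
Proof. by rewrite outcomeS /next_move -/(outcome s0 s1 v n) => ->. Qed.

End Outcomes.

Lemma mean_payoff_eventually (R : realType) (G : arena) (i : player)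
    (pi : nat -> G) (a : int) (n : nat) :
  (forall m, (n <= m)%N -> weight i (pi m) (pi m.+1) = a) ->
  mean_payoff R i pi = (a%:~R)%:E.
Proof.
move=> wa; pose u (m : nat) : R := (weight i (pi m) (pi m.+1))%:~R.
have u_cvg : (u @ \oo --> (a%:~R : R))%classic.
  by apply: cvg_near_cst; exists n => // m /= nm; rewrite /u wa.
have mean_cvg := cesaro u_cvg.
rewrite /mean_payoff; apply: (cvg_limn_einf_sup _).1.
apply: cvg_EFin; first by exact: nearW.
(* [arithmetic_mean u k] divides by [k.+1], so it is the average at index [k.+1]; the shift drops
   index 0, where [0^-1] is 0. *)
rewrite -cvg_shiftS.
rewrite [X in (X @ _)%classic](_ : _ = arithmetic_mean u) //.
by apply/funext => k; rewrite /arithmetic_mean /series /= rmorph_sum big_mkord.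
Qed.

(* A strategy sees the first vertex of the history, so responses that are
   optimal from each vertex can be glued. *)
Lemma best_response_neq0 (R : realType) (G : arena) (s0 : strategy G P0)
    (eps : R) : 0 < eps ->
  (forall v : G, exists s1 : strategy G P1,
    mean_payoff R P1 (outcome s0 s1 v) \is a fin_num /\
    forall s1' : strategy G P1,
      (mean_payoff R P1 (outcome s0 s1' v)
         <= mean_payoff R P1 (outcome s0 s1 v))%E) ->
  exists s1, best_response eps s0 s1.
Proof.
move=> eps0 /choice[opt optP].
have move_optP v p : history v p -> owner (last v p) = P1 ->
    edge (last v p) (opt v v p) by exact: move_ofP.
exists (Strategy move_optP) => v s1'.
have [fin_opt max_opt] := optP v.
have -> : outcome s0 (Strategy move_optP) v = outcome s0 (opt v) v by [].
apply: le_lt_trans (leeB (max_opt s1') (lexx _)) _.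
by rewrite lteBlDr // lteDl // lte_fin.
Qed.

(** * The game and the strategies used in it *)

Inductive place := Hub | Fork | Win | Lose.

Definition bools_of_place x :=
  match x with
  | Hub => (false, false) | Fork => (false, true)
  | Win => (true, false) | Lose => (true, true)
  end.

Definition place_of_bools b :=
  match b with
  | (false, false) => Hub | (false, true) => Fork
  | (true, false) => Win | (true, true) => Lose
  end.

Lemma bools_of_placeK : cancel bools_of_place place_of_bools.
Proof. by case. Qed.

HB.instance Definition _ := Finite.copy place (can_type bools_of_placeK).

Definition place_edge : rel place := fun x y =>
  match x, y with
  | Hub, Fork | Hub, Lose | Fork, Hub | Fork, Win | Win, Win | Lose, Lose => true
  | _, _ => false
  end.

Lemma place_edge_total x : exists y, place_edge x y.
Proof.
by case: x; [exists Fork | exists Hub | exists Win | exists Lose].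
Qed.

Definition place_owner x := if x is Fork then P1 else P0.

Definition place_weight (i : player) (x _ : place) : int :=
  match i, x with
  | P0, Win => 1
  | P1, Hub | P1, Fork => 1
  | P1, Lose => -1
  | _, _ => 0
  end.

Definition game : arena := Arena place_edge_total place_owner place_weight.

(** The test [p is [::]] recognises the start of the play: a play from [Fork] that enters [Hub] is
    punished at once. *)
Definition punish_move (v : game) (p : seq game) : game :=
  match last v p with
  | Hub => if p is [::] then Fork else Lose
  | Fork => Hub
  | x => x
  end.

Lemma punish_moveP v p : @history game v p -> owner (last v p) = P0 ->
  edge (last v p) (punish_move v p).
Proof. by rewrite /punish_move; case: (last v p) => //; case: p. Qed.

Definition punish : strategy game P0 := Strategy punish_moveP.

Definition fork_move (y : game) (v : game) (p : seq game) : game :=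
  if last v p is Fork then y else last v p.

Lemma fork_moveP (y : game) : edge (Fork : game) y ->
  forall v p, @history game v p -> owner (last v p) = P1 ->
  edge (last v p) (fork_move y v p).
Proof. by move=> Fy v p _; rewrite /fork_move; case: (last v p). Qed.

Definition at_fork (y : game) (Fy : edge (Fork : game) y) : strategy game P1 :=
  Strategy (fork_moveP Fy).

Definition leave : strategy game P1 := @at_fork Win isT.
Definition come_back : strategy game P1 := @at_fork Hub isT.

(** * The three possible payoff pairs, and bounds on the values *)

Section Payoffs.
Variables (R : realType) (s0 : strategy game P0).
Implicit Types (v : game) (a b : R).

Definition payoffs (s1 : strategy game P1) v a b :=
  mean_payoff R P0 (outcome s0 s1 v) = a%:E /\
  mean_payoff R P1 (outcome s0 s1 v) = b%:E.

Lemma payoffs_cycle s1 v :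
  (forall n, outcome s0 s1 v n = Hub \/ outcome s0 s1 v n = Fork) ->
  payoffs s1 v 0 1.
Proof.
move=> cyc; split.
- by apply: (@mean_payoff_eventually R game P0 _ 0 0) => m _; case: (cyc m) => /= ->.
- by apply: (@mean_payoff_eventually R game P1 _ 1 0) => m _; case: (cyc m) => /= ->.
Qed.

Lemma outcome_sink (s1 : strategy game P1) v n x : x = Win \/ x = Lose ->
  outcome s0 s1 v n = x -> forall m, (n <= m)%N -> outcome s0 s1 v m = x.
Proof.
move=> sink_x nx; elim=> [|m IHm]; first by rewrite leqn0 => /eqP <-.
rewrite leq_eqVlt ltnS => /predU1P[<- //|/IHm mx].
have := outcome_edge s0 s1 v m; rewrite mx.
by case: sink_x => ->; case: (outcome s0 s1 v m.+1).
Qed.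

Lemma payoffs_Win s1 v n : outcome s0 s1 v n = Win -> payoffs s1 v 1 0.
Proof.
move=> nW; have mW := outcome_sink (or_introl erefl) nW; split.
- by apply: (@mean_payoff_eventually R game P0 _ 1 n) => m /mW /= ->.
- by apply: (@mean_payoff_eventually R game P1 _ 0 n) => m /mW /= ->.
Qed.

Lemma payoffs_Lose s1 v n : outcome s0 s1 v n = Lose -> payoffs s1 v 0 (-1).
Proof.
move=> nL; have mL := outcome_sink (or_intror erefl) nL; split.
- by apply: (@mean_payoff_eventually R game P0 _ 0 n) => m /mL /= ->.
- rewrite (@mean_payoff_eventually R game P1 _ (-1) n) ?mulrN1z //.
  by move=> m /mL /= ->.
Qed.

(** [Win] and [Lose] are sinks, so reaching one fixes both payoffs; a play that avoids them stays on
    the cycle. *)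
Lemma payoffsP s1 v :
  [\/ payoffs s1 v 0 1, payoffs s1 v 1 0 | payoffs s1 v 0 (-1)].
Proof.
have [[n /payoffs_Win]|noW] := pselect (exists n, outcome s0 s1 v n = Win).
  exact: Or32.
have [[n /payoffs_Lose]|noL] := pselect (exists n, outcome s0 s1 v n = Lose).
  exact: Or33.
apply/Or31/payoffs_cycle => n.
case E: (outcome s0 s1 v n); [by left | by right | |].
- by case: noW; exists n.
- by case: noL; exists n.
Qed.

Lemma game_best_response_neq0 : exists s1, best_response (1 : R) s0 s1.
Proof.
apply: best_response_neq0 => // v.
(* Player 1 has only the payoffs 1, 0 and -1: the first one attainable, in this order, is a
   maximum. *)
have [[s1 [_ p1]]|no1] := pselect (exists s1, payoffs s1 v 0 1).
  exists s1; rewrite p1; split=> // s1'.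
  by case: (payoffsP s1' v) => -[_ ->]; rewrite lee_fin ?ler01 ?lerN10 // lerN1.
have [[s1 [_ p1]]|no0] := pselect (exists s1, payoffs s1 v 1 0).
  exists s1; rewrite p1; split=> // s1'.
  case: (payoffsP s1' v) => [p|[_ ->] //|[_ ->]]; last by rewrite lee_fin lerN10.
  by case: no1; exists s1'.
have pm1 s1 : mean_payoff R P1 (outcome s0 s1 v) = (-1)%:E.
  case: (payoffsP s1 v) => [p|p|[_ ->] //]; [case: no1|case: no0]; by exists s1.
by exists leave; split=> [|s1']; rewrite !pm1.
Qed.

(** A best response exists, so the infimum is over a singleton and not over the empty set, where it
    would be infinite. *)
Lemma ASV_of_const a v :
  (forall s1, best_response (1 : R) s0 s1 ->
    mean_payoff R P0 (outcome s0 s1 v) = a%:E) ->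
  ASV_of (1 : R) s0 v = a%:E.
Proof.
move=> br_a; rewrite /ASV_of [X in ereal_inf X](_ : _ = [set a%:E]%classic).
  by rewrite ereal_inf1.
apply/seteqP; split=> [_ [s1 br1 <-]|_ ->]; first exact: br_a.
by have [s1 br1] := game_best_response_neq0; exists s1 => //; exact: br_a.
Qed.

Lemma ASV_of_le1 v : (ASV_of (1 : R) s0 v <= 1%:E)%E.
Proof.
have [s1 br1] := game_best_response_neq0.
apply: (@le_trans _ _ (mean_payoff R P0 (outcome s0 s1 v))).
  by apply: ereal_inf_lbound; exists s1.
by case: (payoffsP s1 v) => -[-> _]; rewrite lee_fin.
Qed.

End Payoffs.

(** * Value of [punish], of the game and of memoryless strategies *)

Lemma punish_payoffs (R : realType) (s1 : strategy game P1) :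
  payoffs punish s1 Hub (1 : R) 0 \/ payoffs punish s1 Hub (0 : R) (-1).
Proof.
have o1 : outcome punish s1 Hub 1 = Fork by [].
have := outcome_edge punish s1 Hub 1; rewrite o1.
(* The choice at [Fork] decides: a return to [Hub] is followed by [Lose] at time 3. *)
case o2: (outcome punish s1 Hub 2) => // _.
  right; apply: (@payoffs_Lose _ _ _ _ 3); rewrite outcomeS_P0 ?o2 //.
  by rewrite [LHS]/= /punish_move -/(outcome punish s1 Hub 2) o2.
by left; exact: payoffs_Win o2.
Qed.

(** Against [leave], which gives Player 1 payoff 0, a response ending in [Lose] falls short by
    exactly 1, and the inequality defining best responses is strict. *)
Lemma ASV_of_punish (R : realType) : ASV_of (1 : R) punish Hub = 1%:E.
Proof.
apply: ASV_of_const => s1 /(_ Hub leave).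
have [_ ->] : payoffs punish leave Hub (1 : R) 0 by exact: (@payoffs_Win _ _ _ _ 2).
case: (punish_payoffs R s1) => -[-> ->] //.
by rewrite -EFinB lte_fin sub0r ltxx.
Qed.

Lemma ASV_game (R : realType) : ASV (1 : R) (Hub : game) = 1%:E.
Proof.
apply/le_anti/andP; split.
  by apply: ge_ereal_sup => _ [s0 _ <-]; exact: ASV_of_le1.
by rewrite -ASV_of_punish; apply: ereal_sup_ubound; exists punish.
Qed.

Lemma ASV_of_memoryless (R : realType) (t0 : strategy game P0) :
  memoryless t0 -> ASV_of (1 : R) t0 Hub = 0%:E.
Proof.
move=> [f t0f]; apply: ASV_of_const => s1 br1.
have t0_Hub s n : outcome t0 s Hub n = Hub -> outcome t0 s Hub n.+1 = f Hub.
  move=> nH; rewrite outcomeS_P0 ?nH // t0f //.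
  - by congr f; exact: nH.
  - exact: outcome_prefix_history.
  - by rewrite -/(outcome t0 s Hub n) nH.
case fH: (f Hub).
- by have := outcome_edge t0 s1 Hub 0; rewrite t0_Hub ?fH.
- have [_ ret] : payoffs t0 come_back Hub (0 : R) 1.
    apply: payoffs_cycle; elim=> [|n [nH|nF]]; first by left.
    + by right; rewrite t0_Hub.
    + by left; rewrite outcomeS_P1 ?nF //= /fork_move -/(outcome _ _ _ n) nF.
  (* Cycling is worth 1 to Player 1, so a response ending in [Win], worth 0, is excluded; the other
     two outcomes pay 0 to Player 0. *)
  have := br1 Hub come_back; rewrite ret -EFinB subrr.
  by case: (payoffsP R t0 s1 Hub) => -[-> ->] //; rewrite lte_fin ltxx.
- by have := outcome_edge t0 s1 Hub 0; rewrite t0_Hub ?fH.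
- by have [] : payoffs t0 s1 Hub (0 : R) (-1)
    by apply: (@payoffs_Lose _ _ _ _ 1); rewrite t0_Hub.
Qed.

(** One bit suffices: it turns true once a vertex is read, and [belast v p] is empty exactly when
    [p] is. *)
Lemma punish_finite_memory : finite_memory punish.
Proof.
exists bool, false, (fun _ _ => true),
  (fun seen x => match x with
                 | Hub => if seen then Lose else Fork
                 | Fork => Hub
                 | x => x
                 end) => v p _ _.
rewrite /= /punish_move; case: (last v p) => //.
by case: p => [//|x p] /=; elim: p x => //= y p IHp x.
Qed.

Theorem theorem35 (R : realType) :
  exists (G : arena) (v : G) (eps : R) (s0 : strategy G P0),
    0 < eps /\
    [/\ finite_memory s0,
        ~ memoryless s0,
        ASV_of eps s0 v = ASV eps v
      & forall t0 : strategy G P0, memoryless t0 -> ASV_of eps t0 v <> ASV eps v].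
Proof.
have memoryless_neq (t0 : strategy game P0) :
    memoryless t0 -> ASV_of (1 : R) t0 Hub <> ASV (1 : R) (Hub : game).
  move=> /(@ASV_of_memoryless R) ->; rewrite ASV_game => -[] /esym/eqP.
  by rewrite oner_eq0.
have optimal : ASV_of (1 : R) punish Hub = ASV (1 : R) (Hub : game).
  by rewrite ASV_of_punish ASV_game.
exists game, Hub, 1, punish; split=> //; split=> //.
  exact: punish_finite_memory.
(* Were [punish] memoryless, it would miss the value, against [optimal]. *)
by move=> /memoryless_neq.
Qed.
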